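(* Let $\mathfrak{X}$ be a saturated fusion action system of a finite $p$-group $S$ on a finite set $X$, let $G=\mathfrak{X}(1)$, and let $\mathcal{C}$ be the core fusion system associated to $\mathfrak{X}$. Then the fusion action system $\mathfrak{X}$ determines a unique homomorphism $\kappa:G\to\mathrm{Out}(\mathcal{C})$.
   Context: Let $p$ be a prime, $S$ a finite $p$-group, and $X$ a finite set with a left $S$-action; $\Sigma_X$ is the symmetric group on $X$, $\ell_s\in\Sigma_X$ is the permutation $x\mapsto s\cdot x$, and $c_s$ is conjugation $h\mapsto shs^{-1}$. $\mathrm{Inj}(P,Q)$ is the set of injective homomorphisms $P\to Q$. A pair $(\varphi,\sigma)\in\mathrm{Inj}(P,Q)\times\Sigma_X$ ($P,Q\le S$) is intertwined if $\sigma\ell_p\sigma^{-1}=\ell_{\varphi(p)}$ for all $p\in P$. Let $\mathfrak{U}$ be the category whose objects are all subgroups of $S$ and whose morphisms $P\to Q$ are the intertwined pairs, composed componentwise. Let $\mathfrak{X}_S\subseteq\mathfrak{U}$ have the same objects and morphisms $P\to Q$ the pairs $(c_s|_P,\ell_s)$ with $s\in S$, $sPs^{-1}\le Q$. A fusion action system of $S$ on $X$ is a category $\mathfrak{X}$ with $\mathfrak{X}_S\subseteq\mathfrak{X}\subseteq\mathfrak{U}$ such that every morphism of $\mathfrak{X}$ factors as an isomorphism of $\mathfrak{X}$ followed by an inclusion $(\mathrm{incl},\mathrm{id}_X)$. Write $\mathfrak{X}(P)=\mathfrak{X}(P,P)$ and $\mathfrak{X}(P,Q)_{\mathrm{iso}}$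 for the isomorphisms; $\mathfrak{X}(1)$ (automorphisms of the trivial subgroup) is identified with a subgroup of $\Sigma_X$. The underlying fusion system $\mathcal{F}^{\mathfrak{X}}$ has the subgroups of $S$ as objects and $\mathcal{F}^{\mathfrak{X}}(P,Q)=\{\varphi : \exists\sigma,\ (\varphi,\sigma)\in\mathfrak{X}(P,Q)\}$; two subgroups are conjugate if they are isomorphic in $\mathcal{F}^{\mathfrak{X}}$. Let $C=\{s\in S:\ell_s=\mathrm{id}_X\}$ be the core of the $S$-action, $N_S(P;X)=N_S(P)\cap C$, $Z_S(P;X)=Z_S(P)\cap C$. A subgroup $P\le S$ is fully normalized (resp. fully centralized, fully $X$-normalized, fully $X$-centralized) if $|N_S(P)|\ge|N_S(Q)|$ (resp. the same inequality for $Z_S(-)$, $N_S(-;X)$, $Z_S(-;X)$) for all $Q$ conjugate to $P$. Put $\mathrm{Aut}_S(P)=\{c_s|_P:s\in N_S(P)\}$, $\mathrm{Aut}_S(P;X)=\{(c_s|_P,\ell_s):s\in N_S(P)\}$, $\Sigma_{\mathfrak{X}}(P)=\{\sigma:\exists\varphi,(\varphi,\sigma)\in\mathfrak{X}(P)\}$, $\Sigma^S_{\mathfrak{X}}(P)=\{\ell_s:s\in N_S(P)\}$, $\mathcal{F}^{\mathfrak{X}}(P)_0=\{\varphi:(\varphi,\mathrm{id}_X)\in\mathfrak{X}(P)\}$, $\mathcal{F}_S(P)_0=\{c_s|_P:s\in N_S(P;X)\}$, $\Sigma_{\mathfrak{X}}(P)_0=\{\sigma:(\mathrm{id}_P,\sigma)\in\mathfrak{X}(P)\}$,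 $\Sigma^S_{\mathfrak{X}}(P)_0=\{\ell_s:s\in Z_S(P)\}$. The extender of $(\varphi,\sigma)\in\mathfrak{X}(P,Q)_{\mathrm{iso}}$ is $N_{(\varphi,\sigma)}=\{n\in N_S(P):(\varphi c_n\varphi^{-1},\sigma\ell_n\sigma^{-1})\in\mathrm{Aut}_S(Q;X)\}$. $\mathfrak{X}$ is saturated if: (1) for every $P\le S$, fully normalized implies fully $X$-normalized and fully centralized, and each of fully $X$-normalized and fully centralized implies fully $X$-centralized; (2) if $P$ is fully normalized then $\mathrm{Aut}_S(P)\in\mathrm{Syl}_p(\mathcal{F}^{\mathfrak{X}}(P))$, $\mathrm{Aut}_S(P;X)\in\mathrm{Syl}_p(\mathfrak{X}(P))$ and $\Sigma^S_{\mathfrak{X}}(P)\in\mathrm{Syl}_p(\Sigma_{\mathfrak{X}}(P))$; (3) if $P$ is fully $X$-normalized then $\mathcal{F}_S(P)_0\in\mathrm{Syl}_p(\mathcal{F}^{\mathfrak{X}}(P)_0)$; (4) if $P$ is fully centralized then $\Sigma^S_{\mathfrak{X}}(P)_0\in\mathrm{Syl}_p(\Sigma_{\mathfrak{X}}(P)_0)$; (5) if $Q$ is fully $X$-centralized and $(\varphi,\sigma)\in\mathfrak{X}(P,Q)_{\mathrm{iso}}$, there is $(\widetilde\varphi,\sigma)\in\mathfrak{X}(N_{(\varphi,\sigma)},S)$ with $\widetilde\varphi|_P=\varphi$. The core fusion system $\mathcal{C}$ is the fusion system on $C$ whose objects are the subgroups of $C$ and whose morphisms are $\mathcal{C}(P,Q)=\{\varphi\in\mathrm{Inj}(P,Q):(\varphi,\mathrm{id}_X)\in\mathfrak{X}(P,Q)\}$.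 $\mathrm{Aut}(\mathcal{C})$ is the group of fusion-preserving automorphisms of $C$: those $\alpha\in\mathrm{Aut}(C)$ for which there is a functor $F_\alpha:\mathcal{C}\to\mathcal{C}$ with $F_\alpha(P)=\alpha(P)$ and $F_\alpha(\varphi)\circ\alpha|_P=\alpha\circ\varphi$ for all $\varphi\in\mathcal{C}(P,Q)$; equivalently $\alpha\,\mathcal{C}(P,Q)\,\alpha^{-1}=\mathcal{C}(\alpha P,\alpha Q)$ for all $P,Q\le C$. $\mathrm{Inn}(\mathcal{C})=\mathcal{C}(C)$ is a normal subgroup of it, and $\mathrm{Out}(\mathcal{C})=\mathrm{Aut}(\mathcal{C})/\mathrm{Inn}(\mathcal{C})$. *)

(* Defs.v *)
From mathcomp Require Import all_boot all_fingroup all_solvable.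

Set Implicit Arguments.
Unset Strict Implicit.
Unset Printing Implicit Defensive.

Local Open Scope group_scope.

(* Conventions.
   - The ambient group [S] is a whole finGroupType, so the subgroups of S are
     the elements of [{group S}], N_S(P) = 'N(P) and Z_S(P) = 'C(P).
   - [X] is the finite set acted on, [XX] a fusion action system on it.
   - Products of permutations are composed from left to right:
     [(s * t) x = t (s x)]. Hence {perm X} is the opposite of the group Sigma_X
     of functions under composition, and likewise [Aut P <= {perm S}] is the
     opposite of Aut(P). Being a homomorphism between two such groups,
     subgroups, normality, Sylow subgroups and quotients are insensitive to
     taking opposites on both sides.
   - [x ^ y = y^-1 * x * y], so [ell p ^ sigma] is the map
     sigma o ell_p o sigma^-1. *)

Record left_action (S : finGroupType) (X : finType) := LeftAction {
  lact :> S -> X -> X;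
  lact1 : forall x, lact 1 x = x;
  lactM : forall s t x, lact (s * t) x = lact s (lact t x)
}.

Section FusionActionSystems.

Variables (S : finGroupType) (X : finType) (A : left_action S X).

Lemma lact_inj s : injective (A s).
Proof. by move=> x y /(congr1 (A s^-1)); rewrite -!lactM mulVg !lact1. Qed.

Definition ell (s : S) : {perm X} := perm (@lact_inj s).

Lemma ellE s x : ell s x = A s x. Proof. exact: permE. Qed.

Lemma ell1 : ell 1 = 1.
Proof. by apply/permP => x; rewrite ellE lact1 perm1. Qed.

Lemma ellM s t : ell (s * t) = ell t * ell s.
Proof. by apply/permP => x; rewrite permM !ellE lactM. Qed.

Definition core : {set S} := [set s | ell s == 1].

Lemma core_group_set : group_set core.
Proof.
apply/group_setP; split=> [|s t]; rewrite !inE ?ell1 //.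
by move=> /eqP es /eqP et; rewrite ellM es et mulg1.
Qed.
Canonical core_group := Group core_group_set.

(* A map defined on a subgroup P is encoded by its extension to S with value 1
   outside P, so that equality of maps on P is Leibniz equality; the composite
   of two homomorphisms is then the plain composite of the encodings. Inclusions
   and identities on P both have encoding [res P id]. *)

Definition fmap := {ffun S -> S}.
Definition pmap := (fmap * {perm X})%type.

Definition res (P : {set S}) (f : S -> S) : fmap :=
  [ffun x => if x \in P then f x else 1].

Definition fcomp (g f : fmap) : fmap := [ffun x => g (f x)].

Definition finv (P : {set S}) (f : fmap) : fmap :=
  [ffun y => odflt 1 [pick x in P | f x == y]].

Definition Inj (P Q : {group S}) : {set fmap} :=
  [set f : fmap | [&& res P f == f, morphic P f,
    [forall x in P, forall y in P, (f x == f y) ==> (x == y)] &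
    f @: P \subset Q]].

Definition cmap (P : {set S}) (s : S) : fmap :=
  res P (fun x => s * x * s^-1).

Definition pcomp (g f : pmap) : pmap := (fcomp g.1 f.1, f.2 * g.2).
Definition pincl (P : {set S}) : pmap := (res P id, 1).
Definition pinv (P : {set S}) (f : pmap) : pmap := (finv P f.1, f.2^-1).
Definition pconj (P : {set S}) (s : S) : pmap := (cmap P s, ell s).

(* The hom-sets of the categories U and X_S. *)
Definition Umor (P Q : {group S}) : {set pmap} :=
  [set f : pmap | (f.1 \in Inj P Q) &&
    [forall x in P, ell x ^ f.2 == ell (f.1 x)]].

Definition XSmor (P Q : {group S}) : {set pmap} :=
  [set pconj P s | s : S & [set s * x * s^-1 | x in P] \subset Q].

Definition iso_in (T : eqType) (comp : T -> T -> T) (idm : {group S} -> T)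
    (mor : {group S} -> {group S} -> pred T) P Q (f g : T) : bool :=
  [&& mor P Q f, mor Q P g, comp g f == idm P & comp f g == idm Q].

Definition Xiso (mor : {group S} -> {group S} -> {set pmap}) P Q : {set pmap} :=
  [set f | [exists g, iso_in pcomp (fun R : {group S} => pincl R)
                        (fun P Q h => h \in mor P Q) P Q f g]].

(* Identities are in X because they are in X_S. *)
Record fusion_action_system := FusionActionSystem {
  Xmor :> {group S} -> {group S} -> {set pmap};
  Xmor_sub : forall P Q, Xmor P Q \subset Umor P Q;
  Xmor_sup : forall P Q, XSmor P Q \subset Xmor P Q;
  Xmor_comp : forall P Q R f g,
    f \in Xmor P Q -> g \in Xmor Q R -> pcomp g f \in Xmor P R;
  Xmor_factor : forall P Q f, f \in Xmor P Q ->
    exists (R : {group S}) (g : pmap),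
      [/\ g \in Xiso Xmor P R, R \subset Q & f = pcomp (pincl R) g]
}.

(* Sets of self-maps of P, transported to the group Aut P <= {perm S} of
   automorphisms of P extended by the identity outside P. *)
Definition as_aut (P : {set S}) (B : {set fmap}) : {set {perm S}} :=
  [set a in Aut P | res P a \in B].

Definition as_autX (P : {set S}) (B : {set pmap}) : {set {perm S} * {perm X}} :=
  [set a : {perm S} * {perm X} | (a.1 \in Aut P) && ((res P a.1, a.2) \in B)].

Section System.

Variable XX : fusion_action_system.

Definition Fmor (P Q : {group S}) : {set fmap} :=
  [set phi : fmap | [exists sigma, (phi, sigma) \in XX P Q]].

Definition conjugate (P Q : {group S}) : bool :=
  [exists phi, exists psi, iso_in fcomp (fun R : {group S} => res R id)
     (fun P Q h => h \in Fmor P Q) P Q phi psi].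

Definition fully (sub : {group S} -> {set S}) (P : {group S}) : Prop :=
  forall Q : {group S}, conjugate P Q -> #|sub Q| <= #|sub P|.

Definition NX (P : {group S}) : {set S} := 'N(P) :&: core.
Definition ZX (P : {group S}) : {set S} := 'C(P) :&: core.

Definition fully_normalized := fully (fun P => 'N(P)).
Definition fully_centralized := fully (fun P => 'C(P)).
Definition fully_Xnormalized := fully NX.
Definition fully_Xcentralized := fully ZX.

Definition AutS (P : {group S}) : {set fmap} := [set cmap P s | s in 'N(P)].
Definition AutSX (P : {group S}) : {set pmap} := [set pconj P s | s in 'N(P)].
Definition SigmaX (P : {group S}) : {set {perm X}} :=
  [set sigma : {perm X} | [exists phi, (phi, sigma) \in XX P P]].
Definition SigmaXS (P : {group S}) : {set {perm X}} := [set ell s | s in 'N(P)].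
Definition FX0 (P : {group S}) : {set fmap} :=
  [set phi : fmap | (phi, 1) \in XX P P].
Definition FS0 (P : {group S}) : {set fmap} := [set cmap P s | s in NX P].
Definition SigmaX0 (P : {group S}) : {set {perm X}} :=
  [set sigma : {perm X} | (res P id, sigma) \in XX P P].
Definition SigmaXS0 (P : {group S}) : {set {perm X}} := [set ell s | s in 'C(P)].

Definition extender (P Q : {group S}) (f : pmap) : {set S} :=
  [set n in 'N(P) | pcomp f (pcomp (pconj P n) (pinv P f)) \in AutSX Q].

(* The extender of an isomorphism is already a subgroup (see [gen_extender]);
   generation only turns it into an object of the category. *)
Record saturated (p : nat) : Prop := Saturated {
  sat_normalized : forall P, fully_normalized P ->
    fully_Xnormalized P /\ fully_centralized P;
  sat_Xnormalized : forall P, fully_Xnormalized P -> fully_Xcentralized P;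
  sat_centralized : forall P, fully_centralized P -> fully_Xcentralized P;
  sat_SylF : forall P, fully_normalized P ->
    p.-Sylow(as_aut P (Fmor P P)) (as_aut P (AutS P));
  sat_SylX : forall P, fully_normalized P ->
    p.-Sylow(as_autX P (XX P P)) (as_autX P (AutSX P));
  sat_SylSigma : forall P, fully_normalized P ->
    p.-Sylow(SigmaX P) (SigmaXS P);
  sat_SylF0 : forall P, fully_Xnormalized P ->
    p.-Sylow(as_aut P (FX0 P)) (as_aut P (FS0 P));
  sat_SylSigma0 : forall P, fully_centralized P ->
    p.-Sylow(SigmaX0 P) (SigmaXS0 P);
  sat_extend : forall (P Q : {group S}) (f : pmap),
    fully_Xcentralized Q -> f \in Xiso XX P Q ->
    exists2 phi : fmap, (phi, f.2) \in XX <<extender P Q f>>%G [set: S]%G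
                      & res P phi = f.1
}.

(* X(1), identified with a subgroup of Sigma_X. *)
Definition X1 : {set {perm X}} := SigmaX 1%G.

(* The hom-sets of the core fusion system, meaningful for P, Q <= core. *)
Definition Cmor (P Q : {group S}) : {set fmap} :=
  [set phi in Inj P Q | (phi, 1) \in XX P Q].

Definition amap (alpha : {perm S}) (phi : fmap) : fmap :=
  [ffun y => alpha (phi (alpha^-1 y))].

(* For alpha in Aut(C), [alpha @: P] is a subgroup and [<< >>] is only there to
   make it an element of [{group S}] (see [gen_Aut_imset]). *)
Definition gimg (alpha : {perm S}) (P : {group S}) : {group S} :=
  [group of <<alpha @: P>>].

Definition AutC : {set {perm S}} :=
  [set alpha in Aut core |
    [forall P : {group S}, forall Q : {group S},
      (P \subset core) && (Q \subset core) ==>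
      ([set amap alpha phi | phi in Cmor P Q]
         == Cmor (gimg alpha P) (gimg alpha Q))]].

Definition InnC : {set {perm S}} := as_aut core (Cmor core_group core_group).

Lemma resE (P : {set S}) f x : x \in P -> res P f x = f x.
Proof. by move=> Px; rewrite ffunE Px. Qed.

Lemma resN (P : {set S}) f x : x \notin P -> res P f x = 1.
Proof. by move=> Px; rewrite ffunE (negPf Px). Qed.

Lemma fcompE g f x : fcomp g f x = g (f x). Proof. exact: ffunE. Qed.

Lemma InjP (P Q : {group S}) (f : fmap) :
  reflect [/\ forall x, x \notin P -> f x = 1,
             {in P &, {morph f : x y / x * y}}, {in P &, injective f}
           & forall x, x \in P -> f x \in Q] (f \in Inj P Q).
Proof.
rewrite inE; apply: (iffP and4P) => [[/eqP fP /morphicP fM fI fQ] | [f1 fM fI fQ]].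
  split=> // [x xP | x y Px Py /eqP fxy | x Px]; first by rewrite -fP resN.
    by apply/eqP; have /forall_inP/(_ y Py)/implyP := forall_inP fI x Px; apply.
  by rewrite (subsetP fQ) ?imset_f.
split; first by apply/eqP/ffunP=> x; rewrite ffunE; case: ifPn => // /f1.
- exact/morphicP.
- apply/forall_inP=> x Px; apply/forall_inP=> y Py; apply/implyP=> /eqP fxy.
  by rewrite (fI x y).
by apply/subsetP=> _ /imsetP[x Px ->]; apply: fQ.
Qed.

Lemma XInj P Q f : f \in XX P Q -> f.1 \in Inj P Q.
Proof. by move/(subsetP (Xmor_sub XX P Q)); rewrite inE => /andP[]. Qed.

Lemma Inj1 P Q (f : fmap) : f \in Inj P Q -> f 1 = 1.
Proof.
by case/InjP=> _ fM _ _; apply: (mulgI (f 1)); rewrite -fM ?mulg1.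
Qed.

Lemma pconj1 (P : {set S}) : pconj P 1 = pincl P.
Proof.
rewrite /pconj /pincl ell1; congr (_, _); apply/ffunP=> x.
by rewrite !ffunE mul1g invg1 mulg1.
Qed.

Lemma Xincl (P Q : {group S}) : P \subset Q -> pincl P \in XX P Q.
Proof.
move=> sPQ; apply: (subsetP (Xmor_sup XX P Q)); rewrite -pconj1 imset_f // inE.
by apply/subsetP=> _ /imsetP[x Px ->]; rewrite mul1g invg1 mulg1 (subsetP sPQ).
Qed.

Lemma CmorE P Q phi : (phi \in Cmor P Q) = ((phi, 1) \in XX P Q).
Proof. by rewrite inE; apply: andb_idl => /XInj. Qed.

Lemma CmorM P Q R f g : f \in Cmor P Q -> g \in Cmor Q R -> fcomp g f \in Cmor P R.
Proof.
rewrite !CmorE => Xf /(Xmor_comp Xf).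
by rewrite /pcomp /= mulg1.
Qed.

Lemma SigmaX_group_set P : group_set (SigmaX P).
Proof.
apply/group_setP; split=> [|s t].
  by rewrite inE; apply/existsP; exists (res P id); apply: Xincl.
rewrite !inE => /existsP[f Xf] /existsP[g Xg]; apply/existsP; exists (fcomp g f).
exact: (Xmor_comp Xf Xg).
Qed.
Canonical SigmaX_group P := Group (SigmaX_group_set P).
Canonical X1_group := [group of X1].

Lemma InnC_group_set : group_set InnC.
Proof.
apply/group_setP; split=> [|a b].
  rewrite inE group1 CmorE; have -> : res core (1 : {perm S}) = res core id.
    by apply/ffunP=> x; rewrite !ffunE perm1.
  exact: (@Xincl core_group core_group).
move=> /setIdP[Aa Ca] /setIdP[Ab Cb]; rewrite inE groupM //=.
have -> : res core (a * b)%g = fcomp (res core b) (res core a).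
  apply/ffunP=> x; rewrite [RHS]ffunE; have [Cx|Cx] := boolP (x \in core).
    by rewrite (resE (a * b) Cx) (resE a Cx) permM resE ?(Aut_closed Aa).
  by rewrite !(resN _ Cx) resE ?group1 // -(autmE Ab) morph1.
exact: CmorM Ca Cb.
Qed.
Canonical InnC_group := Group InnC_group_set.

Lemma gen_Aut_imset (a : {perm S}) (P : {group S}) :
  a \in Aut core -> P \subset core -> <<a @: P>> = a @: P.
Proof.
move=> Aa sPC; rewrite -(autmE Aa) -(morphimEsub _ sPC).
exact: genGid.
Qed.

Lemma Aut_imset_sub (a : {perm S}) (P : {group S}) :
  a \in Aut core -> P \subset core -> <<a @: P>> \subset core.
Proof.
move=> Aa sPC; rewrite gen_Aut_imset //; apply/subsetP=> _ /imsetP[x Px ->].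
by rewrite Aut_closed ?(subsetP sPC).
Qed.

Lemma amapM a b phi : amap (a * b) phi = amap b (amap a phi).
Proof. by apply/ffunP=> x; rewrite !ffunE invMg !permM. Qed.

Lemma AutCP a :
  reflect (a \in Aut core /\ forall P Q : {group S}, P \subset core -> Q \subset core ->
     [set amap a phi | phi in Cmor P Q] = Cmor (gimg a P) (gimg a Q))
   (a \in AutC).
Proof.
apply: (iffP setIdP) => -[Aa H]; split=> //.
  move=> P Q sP sQ; apply/eqP; move/forallP/(_ P)/forallP/(_ Q): H.
  by rewrite sP sQ.
by apply/forallP=> P; apply/forallP=> Q; apply/implyP=> /andP[sP sQ]; rewrite H.
Qed.

Lemma AutC_group_set : group_set AutC.
Proof.
have amap1 phi : amap 1 phi = phi.
  by apply/ffunP=> x; rewrite !ffunE invg1 !perm1.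
have img1 (P : {group S}) : gimg 1 P = P.
  apply/val_inj => /=; rewrite (eq_imset _ (@perm1 S)) imset_id; exact: genGid.
apply/group_setP; split=> [|a b].
  apply/AutCP; split=> // P Q _ _.
  by rewrite !img1 (eq_imset _ amap1) imset_id.
move=> /AutCP[Aa Ha] /AutCP[Ab Hb]; apply/AutCP; split=> [|P Q sP sQ].
  exact: groupM.
have img (R : {group S}) : R \subset core ->
    gimg (a * b) R = gimg b (gimg a R).
  move=> sR; apply/val_inj; rewrite /= (gen_Aut_imset Aa sR) -imset_comp.
  by congr <<_>>; apply: eq_imset => x; rewrite /= permM.
rewrite (img P) // (img Q) // -Hb ?Aut_imset_sub // -Ha // -imset_comp.
by apply: eq_imset => phi /=; rewrite amapM.
Qed.
Canonical AutC_group := Group AutC_group_set.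

Lemma InnC_res a (P : {group S}) : a \in InnC -> P \subset core ->
  res P a \in Cmor P (gimg a P).
Proof.
move=> /setIdP[Aa]; rewrite !CmorE => Xa sPC.
have := Xmor_comp (@Xincl P core_group sPC) Xa; rewrite /pcomp /= mulg1.
have -> : fcomp (res core a) (res P id) = res P a.
  apply/ffunP=> x; rewrite ffunE; have [Px|Px] := boolP (x \in P).
    by rewrite !(resE _ Px) resE ?(subsetP sPC).
  by rewrite !(resN _ Px) resE // -(autmE Aa) morph1.
case/Xmor_factor=> R [[g t] [+ sR]].
rewrite inE => /existsP[[h u]] /and4P[/= Xg Xh _ /eqP[/ffunP gh _]].
rewrite /pcomp /pincl /= mulg1 => -[ag def_t]; rewrite -def_t in Xg.
have [gN _ _ gR] := InjP _ _ _ (XInj Xg); have [_ _ _ hP] := InjP _ _ _ (XInj Xh).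
have def_g : res P a = g.
  rewrite ag; apply/ffunP=> x; rewrite ffunE; have [Px|Px] := boolP (x \in P).
    by rewrite resE ?gR.
  by rewrite /= gN // resE.
suff -> : gimg a P = R by rewrite def_g.
apply/val_inj; rewrite /= gen_Aut_imset //; apply/setP=> y; apply/imsetP/idP.
  by case=> x Px ->; rewrite -(resE a Px) def_g gR.
move=> Ry; exists (h y); first exact: hP.
by rewrite -(resE a (hP y Ry)) def_g; have := gh y; rewrite ffunE resE.
Qed.

Lemma InnC_normal : InnC <| AutC.
Proof.
have amap_inj a : injective (amap a).
  by move=> f g /(congr1 (amap a^-1)); rewrite -!amapM mulgV /amap invg1;
    move/ffunP=> fg; apply/ffunP=> x; have := fg x; rewrite !ffunE !perm1.
have half a (P Q : {group S}) : a \in InnC -> P \subset core -> Q \subset core ->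
    [set amap a phi | phi in Cmor P Q] \subset Cmor (gimg a P) (gimg a Q).
  move=> Ia sP sQ; have Aa : a \in Aut core by case/setIdP: Ia.
  have sPa := Aut_imset_sub Aa sP.
  have PE : gimg a^-1 (gimg a P) = P.
    apply/val_inj; rewrite /= (gen_Aut_imset Aa sP) -imset_comp.
    by rewrite (eq_imset _ (permK a)) imset_id; apply: genGid.
  apply/subsetP=> _ /imsetP[phi Cphi ->].
  have Ci := @InnC_res a^-1 (gimg a P) (groupVr Ia) sPa; rewrite PE in Ci.
  have := CmorM (CmorM Ci Cphi) (InnC_res Ia sQ).
  have [phiN _ _ phiQ] : [/\ forall x, x \notin P -> phi x = 1,
     {in P &, {morph phi : x y / x * y}}, {in P &, injective phi}
           & forall x, x \in P -> phi x \in Q].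
    by apply/InjP; apply: (XInj (f := (phi, 1))); rewrite -CmorE.
  set L := fcomp _ _; suff -> : L = amap a phi by [].
  apply/ffunP=> y; rewrite !ffunE /= gen_Aut_imset //.
  have -> : (y \in a @: P) = (a^-1 y \in P).
    apply/imsetP/idP=> [[x Px ->]|Py]; first by rewrite permK.
    by exists (a^-1 y); rewrite ?permKV.
  case: (boolP (a^-1 y \in P)) => [/phiQ -> // | Py].
  have P1 : phi 1 = 1 by apply: (@Inj1 P Q); move: Cphi; rewrite inE => /andP[].
  by rewrite P1 group1 (phiN _ Py).
have sIA : InnC \subset AutC.
  apply/subsetP=> a Ia; have Aa : a \in Aut core by case/setIdP: Ia.
  apply/AutCP; split=> // P Q sP sQ; apply/eqP; rewrite eqEcard half //=.
  rewrite (card_imset _ (@amap_inj a)).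
  have inv (R : {group S}) : R \subset core -> gimg a^-1 (gimg a R) = R.
    move=> sR; apply/val_inj; rewrite /= (gen_Aut_imset Aa sR) -imset_comp.
    by rewrite (eq_imset _ (permK a)) imset_id; apply: genGid.
  have := @half a^-1 (gimg a P) (gimg a Q) (groupVr Ia).
  rewrite !inv // => /(_ (Aut_imset_sub Aa sP) (Aut_imset_sub Aa sQ))/subset_leq_card.
  by rewrite (card_imset _ (@amap_inj a^-1)).
apply/andP; split=> //; apply/subsetP=> a /AutCP[Aa Ha]; rewrite inE.
apply/subsetP=> _ /imsetP[f If ->].
have aC : gimg a core_group = core_group.
  apply/val_inj; rewrite /= (@gen_Aut_imset a core_group) //; apply/eqP.
  rewrite eqEcard card_imset ?leqnn ?andbT; last exact: perm_inj.
  by apply/subsetP=> _ /imsetP[x Cx ->]; rewrite Aut_closed.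
have := Ha core_group core_group (subxx _) (subxx _); rewrite /= aC => Hc.
case/setIdP: If => Af Cf.
have Afa : f ^ a \in Aut core by rewrite groupJ.
rewrite inE Afa -Hc; apply/imsetP; exists (res core f) => //.
have CV x : (a^-1 x \in core) = (x \in core).
  apply/idP/idP=> [Cx|Cx]; last by rewrite Aut_closed ?groupV.
  by rewrite -(permKV a x) Aut_closed.
apply/ffunP=> x; rewrite !ffunE CV conjgE !permM; case: ifP => // _.
by rewrite -(autmE Aa) morph1.
Qed.

Lemma gen_extender P Q f : f \in Xiso XX P Q -> <<extender P Q f>> = extender P Q f.
Proof.
rewrite inE => /existsP[[g u]].
case/and4P=> /= Xf Xg /eqP[/ffunP gf fu] /eqP[/ffunP fg _].
case: f Xf gf fu fg => f t /= Xf gf fu fg.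
have [fN fM fI fQ] := InjP _ _ _ (XInj Xf); have [gN _ _ gP] := InjP _ _ _ (XInj Xg).
have finvE x : x \in P -> finv P f (f x) = x.
  move=> Px; rewrite ffunE; case: pickP => [y /andP[Py /eqP/fI ->] // | /(_ x)].
  by rewrite Px eqxx.
have surj y : y \in Q -> exists2 x, x \in P & y = f x.
  by move=> Qy; exists (g y); [apply: gP | have := fg y; rewrite /= ffunE resE].
have extP n : reflect (n \in 'N(P) /\ exists2 s, s \in 'N(Q) &
     (forall x, x \in P -> f (n * x * n^-1) = s * f x * s^-1) /\ ell n ^ t = ell s)
    (n \in extender P Q (f, t)).
  apply: (iffP setIdP) => -[Nn H]; split=> //.
    case/imsetP: H => s Ns [/ffunP fs es]; exists s => //.
    split=> [x Px|]; last by rewrite -es conjgE mulgA.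
    by have := fs (f x); rewrite /= !fcompE finvE // !resE ?fQ.
  case: H => s Ns [fs es]; apply/imsetP; exists s => //.
  rewrite /pcomp /pconj /= -es conjgE mulgA; congr (_, _); apply/ffunP=> y.
  rewrite !fcompE; case: (boolP (y \in Q)) => [/surj[x Px ->]|Qy].
    by rewrite finvE // !resE ?fQ // fs.
  have -> : finv P f y = 1.
    rewrite ffunE; case: pickP => //= z /andP[Pz /eqP zy].
    by rewrite -zy fQ in Qy.
  by rewrite (resN _ Qy) resE // mulg1 mulgV (Inj1 (XInj Xf)).
have gE : group_set (extender P Q (f, t)).
  apply/group_setP; split=> [|m n].
    apply/extP; split=> //; exists 1 => //; split=> [x Px|].
      by rewrite !invg1 !mulg1 !mul1g.
    by rewrite !ell1 conj1g.
  move=> /extP[Nm [r Nr [fr er]]] /extP[Nn [s Ns [fs es]]].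
  apply/extP; split; first exact: groupM.
  exists (r * s); first exact: groupM.
  split=> [x Px|]; last by rewrite !ellM conjMg er es.
  have Pnx : n * x * n^-1 \in P.
    have := Px; rewrite -(memJ_norm x (groupVr Nn)).
    by rewrite conjgE invgK mulgA.
  by have := fr _ Pnx; rewrite fs // !invMg !mulgA.
exact: (genGid (Group gE)).
Qed.

Definition OutC : {set coset_of InnC} := AutC / InnC.

Definition XC : {set {perm S} * {perm X}} :=
  as_autX core (XX core_group core_group).

(* kappa sends sigma to the class of every alpha with (alpha, sigma) in X(C),
   such an alpha being fusion-preserving. *)
Definition carried_by (kappa : {perm X} -> coset_of InnC) : Prop :=
  forall alpha sigma, (alpha, sigma) \in XC ->
    alpha \in AutC /\ kappa sigma = coset InnC alpha.

End System.

End FusionActionSystems.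

(* Main.v *)
Require Import Defs.
From mathcomp Require Import all_boot all_fingroup all_solvable.

Set Implicit Arguments.
Unset Strict Implicit.
Unset Printing Implicit Defensive.

Local Open Scope group_scope.

(** Write C for the core. The whole point is that the projection
    [(alpha, sigma) |-> sigma] from the automorphisms of C in the action system
    onto X(1) is surjective. Take sigma in X(1), viewed as an automorphism
    [(1, sigma)] of the trivial subgroup. That subgroup is fully X-centralized,
    since Z_S(1; X) = C is as large as possible, and its extender contains C:
    for n in C, conjugating [ell n = 1] by sigma gives 1 again. The extension
    axiom therefore extends sigma to a morphism defined on a subgroup
    containing C; restricted to C, it takes values in C because it intertwines
    the actions, and it is an automorphism because C is finite
    ([XC_lift_exists]).

    Two automorphisms of C over the same sigma differ by an automorphism over
    the identity, that is, by an element of Inn of the core fusion system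
    ([XC_coset_eq]). Each of them is fusion-preserving, because conjugating a
    morphism [(phi, 1)] by [(alpha, sigma)] leaves the second component equal
    to 1 ([XC_AutC]). So the class of alpha depends on sigma only, which gives
    kappa; it is multiplicative because the pairs [(alpha, sigma)] form a group,
    and surjectivity of the projection forces its values. *)

Section FusionActionSystem.

Variables (S : finGroupType) (X : finType) (A : left_action S X).
Variable XX : fusion_action_system A.

Implicit Types (P Q R : {group S}) (a b : {perm S}) (sigma : {perm X}).

Local Notation C := (core_group A).

Lemma X_restrict P Q R f :
  f \in XX P Q -> R \subset P -> (res R f.1, f.2) \in XX R Q.
Proof.
move=> Xf sRP; have := Xmor_comp (Xincl XX sRP) Xf.
rewrite /Defs.pcomp /pincl /= mul1g.
suff -> : fcomp f.1 (res R id) = res R f.1 by [].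
apply/ffunP=> x; rewrite fcompE; have [Rx|Rx] := boolP (x \in R).
  by rewrite !resE.
by rewrite !(resN _ Rx) (Inj1 (XInj Xf)).
Qed.

(** The isomorphism through which a morphism factors has the image as its
    target, so the inclusion of that image may be replaced by its inclusion
    into any other subgroup containing it. *)
Lemma X_corestrict P Q R f :
  f \in XX P Q -> {in P, forall x, f.1 x \in R} -> f \in XX P R.
Proof.
move=> Xf fR; have [T [g [isog _ def_f]]] := Xmor_factor Xf.
move: isog; rewrite inE => /existsP[h /and4P[Xg Xh _ /eqP[/ffunP gh _]]].
have [_ _ _ hP] := InjP _ _ _ (XInj Xh).
rewrite def_f; apply: Xmor_comp Xg (Xincl XX _).
apply/subsetP=> y Ty; have := fR _ (hP y Ty); have := gh y.
by rewrite def_f /= !fcompE => ->; rewrite !resE.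
Qed.

(** Intertwining forces [ell (f x)] to be a conjugate of [ell x = 1]. *)
Lemma X_core P Q f :
  f \in XX P Q -> P \subset C -> {in P, forall x, f.1 x \in C}.
Proof.
move=> Xf /subsetP sPC x Px.
have := subsetP (Xmor_sub XX P Q) f Xf.
rewrite !inE => /andP[_ /forall_inP/(_ x Px)].
by have := sPC x Px; rewrite inE => /eqP ->; rewrite conj1g eq_sym.
Qed.

(** By finiteness of P, an injective endomorphism is onto. *)
Lemma Inj_Aut P (f : fmap S) : f \in Inj P P -> exists2 a, a \in Aut P & res P a = f.
Proof.
case/InjP=> f1 fM fI fP.
have injf : 'injm (Morphism fM) by apply/injmP.
have imf : Morphism fM @* P = P.
  apply/eqP; rewrite eqEcard card_injm ?leqnn ?andbT //.
  by apply/subsetP=> _ /morphimP[x _ Px ->]; apply: fP.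
exists (aut injf imf); first exact: Aut_aut.
apply/ffunP=> x; have [Px|Px] := boolP (x \in P); last by rewrite resN ?f1.
by rewrite resE // autE.
Qed.

Lemma XC_group_set : group_set (XC XX).
Proof.
apply/group_setP; split=> [|[a s] [b t]].
  rewrite inE group1 /=; have -> : res C (1 : {perm S}) = res C id.
    by apply/ffunP=> x; rewrite !ffunE perm1.
  exact: (Xincl XX (subxx C)).
move=> /setIdP[/= Aa Xa] /setIdP[/= Ab Xb]; rewrite inE groupM //=.
have -> : res C (a * b)%g = fcomp (res C b) (res C a).
  apply/ffunP=> x; rewrite fcompE; have [Cx|Cx] := boolP (x \in C).
    by rewrite (resE (a * b) Cx) (resE a Cx) permM resE ?(Aut_closed Aa).
  by rewrite !(resN _ Cx) resE ?group1 // -(autmE Ab) morph1.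
exact: Xmor_comp Xa Xb.
Qed.
Canonical XC_group := Group XC_group_set.

Lemma XC_Aut a sigma : (a, sigma) \in XC XX -> a \in Aut C.
Proof. by case/setIdP. Qed.

Lemma XC_res a sigma P : (a, sigma) \in XC XX -> P \subset C ->
  (res P a, sigma) \in XX P (gimg a P).
Proof.
case/setIdP=> /= Aa Xa sPC; apply: (@X_corestrict P C) => [|x Px /=].
  have := X_restrict Xa sPC; suff -> : res P (res C a) = res P a by [].
  apply/ffunP=> x /=.
  have [Px|Px] := boolP (x \in P); last by rewrite !resN.
  by rewrite !(resE _ Px) resE ?(subsetP sPC).
by rewrite resE // mem_gen ?imset_f.
Qed.

Lemma gimgK a P : a \in Aut C -> P \subset C -> gimg a^-1 (gimg a P) = P.
Proof.
move=> Aa sPC; apply/val_inj; rewrite /= (gen_Aut_imset Aa sPC) -imset_comp.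
by rewrite (eq_imset _ (permK a)) imset_id genGid.
Qed.

(** [(amap a phi, 1)] is the conjugate of [(phi, 1)] by [(a, sigma)], suitably
    restricted, whose second component is sigma 1 sigma^-1 = 1. *)
Lemma XC_amap a sigma P Q phi : (a, sigma) \in XC XX ->
    P \subset C -> Q \subset C -> phi \in Cmor XX P Q ->
  amap a phi \in Cmor XX (gimg a P) (gimg a Q).
Proof.
move=> Xa sP sQ; rewrite !CmorE => Xphi; have Aa := XC_Aut Xa.
have [phiN _ _ phiQ] := InjP _ _ _ (XInj Xphi).
have XV : (a^-1, sigma^-1) \in XC XX by apply: (groupVr Xa).
have := XC_res XV (Aut_imset_sub Aa sP); rewrite gimgK // => XaV.
have := Xmor_comp (Xmor_comp XaV Xphi) (XC_res Xa sQ).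
rewrite /Defs.pcomp /= mulg1 mulVg; set psi := fcomp _ _.
suff -> : psi = amap a phi by []; apply/ffunP=> y.
rewrite !ffunE /= (gen_Aut_imset Aa sP).
have -> : (y \in a @: P) = (a^-1 y \in P).
  apply/imsetP/idP=> [[x Px ->]|Py]; first by rewrite permK.
  by exists (a^-1 y); rewrite ?permKV.
case: (boolP (a^-1 y \in P)) => [/phiQ -> // | Py].
by rewrite (Inj1 (XInj Xphi)) group1 (phiN _ Py).
Qed.

(** The reverse inclusion between hom-sets is [XC_amap] for the inverse pair. *)
Lemma XC_AutC a sigma : (a, sigma) \in XC XX -> a \in AutC XX.
Proof.
move=> Xa; have Aa := XC_Aut Xa.
have XV : (a^-1, sigma^-1) \in XC XX by apply: (groupVr Xa).
apply/AutCP; split=> // P Q sP sQ; apply/setP=> psi; apply/imsetP/idP.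
  by case=> phi Cphi ->; apply: XC_amap Xa sP sQ Cphi.
move=> Cpsi; exists (amap a^-1 psi); last first.
  by rewrite -amapM mulVg; apply/ffunP=> x; rewrite ffunE invg1 !perm1.
have := XC_amap XV (Aut_imset_sub Aa sP) (Aut_imset_sub Aa sQ) Cpsi.
by rewrite !gimgK.
Qed.

(** The quotient of the two pairs has second component 1, so its first component
    is in [InnC]. *)
Lemma XC_coset_eq a b sigma : (a, sigma) \in XC XX -> (b, sigma) \in XC XX ->
  coset (InnC XX) a = coset (InnC XX) b.
Proof.
move=> Xa Xb; have /subsetP nI := normal_norm (InnC_normal XX).
apply/rcoset_kercosetP; rewrite ?nI ?(XC_AutC Xa) ?(XC_AutC Xb) //.
rewrite mem_rcoset inE CmorE.
have : (a, sigma) * (b, sigma)^-1 \in XC XX by rewrite groupM ?groupV.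
by rewrite inE /= mulgV.
Qed.

Lemma XC_X1 a sigma : (a, sigma) \in XC XX -> sigma \in X1 XX.
Proof.
case/setIdP=> /= Aa Xa; rewrite inE; apply/existsP; exists (res 1%G (res C a)).
apply: X_corestrict (X_restrict Xa (sub1G C)) _ => x /=.
by move=> x1; rewrite resE // (set1P x1) (Inj1 (XInj Xa)) set11.
Qed.

Lemma Inj_triv Q (f : fmap S) : f \in Inj 1%G Q -> f = [ffun=> 1].
Proof.
move=> If; have [f1 _ _ _] := InjP _ _ _ If; apply/ffunP=> x; rewrite ffunE.
by have [/set1P->|/f1->] := boolP (x \in 1%G); rewrite ?(Inj1 If).
Qed.

(** Since Z_S(1) = S, Z_S(1; X) is the whole core, which contains every
    Z_S(Q; X). *)
Lemma fully_Xcentralized1 : fully_Xcentralized XX 1%G.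
Proof.
by move=> Q _; rewrite subset_leq_card // /ZX cent1T setTI subsetIr.
Qed.

(** An inverse exists because X(1) is closed under inverses as a finite set of
    permutations closed under products. *)
Lemma Xiso1 f : f \in XX 1%G 1%G -> f \in Xiso XX 1%G 1%G.
Proof.
case: f => f sigma Xf; have /= fE := Inj_triv (XInj Xf).
have : sigma^-1 \in X1 XX.
  by rewrite groupV inE; apply/existsP; exists f.
rewrite inE => /existsP[g Xg]; rewrite inE; apply/existsP; exists (g, sigma^-1).
have idE : [ffun=> 1] = res 1%G id :> fmap S.
  exact/esym/Inj_triv/(XInj (Xincl XX (subxx 1%G))).
have cE : fcomp [ffun=> 1] [ffun=> 1] = [ffun=> 1] :> fmap S.
  by apply/ffunP=> x; rewrite !ffunE.
rewrite /iso_in Xf Xg /Defs.pcomp /pincl /= mulgV mulVg.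
have /= gE := Inj_triv (XInj Xg).
by rewrite -idE fE gE cE eqxx.
Qed.

(** For n in the core, [(1, sigma)] conjugates [ell n = 1] to [ell 1]. *)
Lemma core_extender1 f : f \in XX 1%G 1%G -> C \subset extender A 1%G 1%G f.
Proof.
move=> Xf; apply/subsetP=> n Cn; rewrite inE norm1 inE.
have ln : ell A n = 1 by apply/eqP; rewrite inE in Cn.
apply/imsetP; exists 1; rewrite ?group1 // pconj1.
rewrite /Defs.pcomp /pconj /pincl /= ln mulg1 mulVg (Inj_triv (XInj Xf)).
congr (_, _); rewrite [RHS](Inj_triv (XInj (Xincl XX (subxx 1%G)))).
by apply/ffunP=> x; rewrite !ffunE.
Qed.

(** Surjectivity of the projection onto X(1), by extending [(1, sigma)]. *)
Lemma XC_lift_exists p sigma : saturated XX p -> sigma \in X1 XX ->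
  exists a, (a, sigma) \in XC XX.
Proof.
move=> satX; rewrite inE => /existsP[f Xf].
have [phi Xphi _] := sat_extend satX fully_Xcentralized1 (Xiso1 Xf).
have sCE : C \subset <<extender A 1%G 1%G (f, sigma)>>%G.
  exact: subset_trans (core_extender1 Xf) (subset_gen _).
have XphiC := X_restrict Xphi sCE.
have {}XphiC := X_corestrict XphiC (X_core XphiC (subxx C)).
have [a Aa def_a] := Inj_Aut (XInj XphiC); exists a.
by rewrite inE /= Aa def_a.
Qed.

(** The default value 1 is only reached for sigma outside X(1). *)
Definition XC_lift sigma : {perm S} := odflt 1 [pick a | (a, sigma) \in XC XX].

Lemma XC_liftP p sigma : saturated XX p -> sigma \in X1 XX ->
  (XC_lift sigma, sigma) \in XC XX.
Proof.
move=> satX /(XC_lift_exists satX)[a Xa].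
by rewrite /XC_lift; case: pickP => //= /(_ a); rewrite Xa.
Qed.

Lemma coset_liftM p : saturated XX p ->
  {in X1 XX &, {morph (fun sigma => coset (InnC XX) (XC_lift sigma)) : s t / s * t}}.
Proof.
move=> satX s t Xs Xt /=; have /subsetP nI := normal_norm (InnC_normal XX).
have [Ls Lt] := (XC_liftP satX Xs, XC_liftP satX Xt).
rewrite -morphM ?nI ?(XC_AutC Ls) ?(XC_AutC Lt) //.
apply: XC_coset_eq (XC_liftP satX (groupM Xs Xt)) _.
by have := groupM Ls Lt.
Qed.

End FusionActionSystem.

Theorem theorem2p4p13 (p : nat) (S : finGroupType) (X : finType)
    (A : left_action S X) (XX : fusion_action_system A) :
  prime p -> p.-group [set: S] -> saturated XX p ->
  (forall sigma, sigma \in X1 XX ->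
     exists alpha, (alpha, sigma) \in XC XX) /\
  exists kappa : {morphism X1 XX >-> coset_of (InnC XX)},
    [/\ kappa @* X1 XX \subset OutC XX,
        carried_by kappa &
        forall kappa' : {morphism X1 XX >-> coset_of (InnC XX)},
          kappa' @* X1 XX \subset OutC XX -> carried_by kappa' ->
          {in X1 XX, kappa' =1 kappa}].
Proof.
move=> _ _ satX; split=> [sigma|]; first exact: (XC_lift_exists satX).
exists (Morphism (coset_liftM satX)); split=> [|a sigma Xa|kappa' _ car' sigma Xs].
- apply/subsetP=> _ /morphimP[sigma _ Xs ->] /=.
  exact/mem_quotient/(XC_AutC (XC_liftP satX Xs)).
- split; first exact: XC_AutC Xa.
  exact: XC_coset_eq (XC_liftP satX (XC_X1 Xa)) Xa.
by have [_ ->] := car' _ _ (XC_liftP satX Xs).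
Qed.
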